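(* There is an absolute constant $C>0$ such that the following holds. Let $p\colon\{0,1\}^n\to\{0,1\}$ be a symmetric $\mathbb{F}_2$-polynomial of degree $d$, with $1\le d\le n$. Then for every $1\le k\le n$, \[ L_{1,k}(p)\;\le\;\Pr_{x\sim\{0,1\}^n}[p(x)=1]\cdot (Cd)^k . \]
   Context: An $\mathbb{F}_2$-polynomial $p$ on $x_1,\dots,x_n$ is symmetric if $p(x)$ depends only on the Hamming weight $|x|=\sum_i x_i$. For $p\colon\{0,1\}^n\to\{0,1\}$ and $S\subseteq[n]$, the Fourier coefficient is $\hat p(S)=\mathbb{E}_{x\sim\{0,1\}^n}[p(x)(-1)^{\sum_{i\in S}x_i}]$ with $x$ uniform, and the level-$k$ Fourier $L_1$ norm is $L_{1,k}(p)=\sum_{S\subseteq[n],|S|=k}|\hat p(S)|$. *)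

(* Defs.v *)
From HB Require Import structures.
From mathcomp Require Import all_boot all_order all_algebra.
From mathcomp Require Import mpoly.
From mathcomp Require Import reals.

Set Implicit Arguments.
Unset Strict Implicit.
Unset Printing Implicit Defensive.

Import GRing.Theory Num.Theory.

Local Open Scope ring_scope.

Definition cube (n : nat) : finType := {ffun 'I_n -> bool}.

Definition hweight (n : nat) (x : cube n) : nat := (\sum_(i < n) x i)%N.

Definition multilinear (n : nat) (P : {mpoly 'F_2[n]}) : Prop :=
  forall m : 'X_{1..n}, m \in msupp P -> forall i : 'I_n, (m i <= 1)%N.

(* The degree of a Boolean function over F_2 is the total degree of the        *)
(* (unique) multilinear polynomial computing it; [msize] is total degree + 1. *)
Definition F2_polynomial_of_degree (n d : nat) (p : cube n -> bool) : Prop :=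
  exists P : {mpoly 'F_2[n]},
    [/\ multilinear P,
        msize P = d.+1
      & forall x : cube n, P.@[fun i => (x i)%:R] = (p x)%:R].

Definition symmetric_fun (n : nat) (p : cube n -> bool) : Prop :=
  forall x y : cube n, hweight x = hweight y -> p x = p y.

Definition expect (R : realType) (n : nat) (f : cube n -> R) : R :=
  (\sum_(x : cube n) f x) / #|cube n|%:R.

Definition prob (R : realType) (n : nat) (A : pred (cube n)) : R :=
  #|[set x : cube n | A x]|%:R / #|cube n|%:R.

Definition fourier_coef (R : realType) (n : nat) (p : cube n -> bool)
    (S : {set 'I_n}) : R :=
  expect (fun x => (p x)%:R * (-1) ^+ (\sum_(i in S) x i)%N).

Definition L1_level (R : realType) (n k : nat) (p : cube n -> bool) : R :=
  \sum_(S : {set 'I_n} | #|S| == k) `|fourier_coef R p S|.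

(* Main.v *)
(** Let [m] be the power of two with [d < m <= 2 d]. The m-th derivative of a
    polynomial of degree [< m] vanishes and the inner binomials [C(m, i)] are
    even, so [p] is a function [g] of [|x| mod m]. Put
    [phi_N(y) = sum_x g(y + |x|) chi_S(x)] with [|S| = k], and
    [pi_N(y) = sum_x g(y + |x|)], for [x] in the cube of dimension [N]; the claim is
    [C(n, k) |phi_n(0)| <= pi_n(0) (C m)^k].

    If [N <= k m^2], Krawtchouk duality gives
    [C(N, k) phi_N(y) = sum_w C(N, w) K_k(w) g(y + w)], and [K_k(w)], a coefficient of
    [(1 - z)^w (1 + z)^(N - w)], is bounded by [r^-k (1 + r^2)^(N/2) (1 + r)^|N - 2w|]
    with [r = 1/(4m)]. This is [(C m)^k] unless [w] is far from [N/2], and along the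
    period [m] the far terms decay geometrically, so that they are absorbed by the
    near ones of the same residue class.

    If [n > k m^2], start from [N = k m^2] and add coordinates in blocks of [16 m^2].
    As [phi] has mean zero over a period, a Doeblin argument shows that each block
    contracts the ratio [|phi| / pi] by a constant factor, and this beats the growth
    of [C(n, k) / C(N, k)]. *)

Require Import Defs.
From mathcomp Require Import all_boot all_order all_algebra reals.
From mathcomp Require Import mpoly.
From mathcomp Require Import ring lra zify.

Set Implicit Arguments.
Unset Strict Implicit.
Unset Printing Implicit Defensive.

Import Order.TTheory GRing.Theory Num.Theory.

Local Open Scope ring_scope.

(** * Periodicity of symmetric polynomials *)

(** [2 ^ t] divides [i * 'C(2 ^ t, i)]; an odd binomial would be coprime to it, so [2 ^ t] would
    divide the smaller positive number [i]. *)
Lemma odd_bin_pow2 (t i : nat) : (0 < i < 2 ^ t)%N -> odd 'C(2 ^ t, i) = false.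
Proof.
case: i => [//|i] /andP[_ lti]; apply/negP => oddC.
have : (2 ^ t %| i.+1 * 'C(2 ^ t, i.+1))%N by rewrite -mul_bin_diag dvdn_mulr.
rewrite mulnC Gauss_dvdr; first by move/(dvdn_leq (ltn0Sn i)); lia.
by rewrite coprimeXl // coprime2n.
Qed.

Lemma addF2 (x : 'F_2) : x + x = 0.
Proof. by apply/val_inj; case: x => [[|[|]]]. Qed.

Lemma natF2_odd (a : nat) : a%:R = (odd a)%:R :> 'F_2.
Proof.
rewrite -[in LHS](odd_double_half a) natrD -muln2 mulnC natrM.
by rewrite (_ : 2%:R = 0) ?mul0r ?addr0 //; apply/val_inj.
Qed.

(* A monomial of degree < #|T| misses some i in T, and toggling i pairs the
   terms of the sum into equal summands, which cancel in characteristic 2. *)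
Lemma sum_subsets_meval_eq0 (n : nat) (P : {mpoly 'F_2[n]}) (Y T : {set 'I_n}) :
  (msize P <= #|T|)%N ->
  \sum_(B : {set 'I_n} | B \subset T) P.@[fun i => (i \in Y :|: B)%:R] = 0.
Proof.
move=> leT; under eq_bigr => B _ do rewrite mevalE.
rewrite exchange_big /= big_seq big1 // => mon /msize_mdeg_lt lt_mon.
rewrite -mulr_sumr.
have [i iT /eqP mi0] : exists2 i, i \in T & mon i == 0%N.
  apply/exists_inP; apply: contraTT (leq_trans lt_mon leT) => /exists_inPn hT.
  rewrite -leqNgt mdegE -sum1_card [leqRHS](bigID (mem T)) /=.
  apply: leq_trans (leq_addr _ _); apply: leq_sum => i iT.
  by rewrite lt0n; apply: hT.
rewrite (bigID (fun B : {set 'I_n} => i \in B)) /=.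
rewrite (reindex_onto (fun B => i |: B) (fun B => B :\ i)) /=; last first.
  by move=> B /andP[_ iB]; rewrite setD1K.
rewrite (_ : \sum_(B | _) _ = \sum_(B : {set 'I_n} | (B \subset T) && (i \notin B))
    \prod_j (j \in Y :|: B)%:R ^+ mon j); first by rewrite addF2 mulr0.
apply: eq_big => [B|B _].
  rewrite setU11 andbT subUset sub1set iT /=; congr andb.
  apply/eqP/idP => [<-|iB]; first by rewrite setD11.
  by rewrite setU1K.
apply: eq_bigr => j _; rewrite !inE; case: eqVneq => [->|//].
by rewrite mi0 !expr0.
Qed.

Lemma sum_subsets_card (V : nmodType) (I : finType) (T : {set I}) (f : nat -> V) :
  \sum_(B : {set I} | B \subset T) f #|B| = \sum_(i < #|T|.+1) f i *+ 'C(#|T|, i).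
Proof.
rewrite (partition_big (fun B : {set I} => inord #|B| : 'I_#|T|.+1) predT) //=.
apply: eq_bigr => i _; rewrite -cards_draws -sumr_const.
rewrite [RHS](eq_bigl (fun B : {set I} => (B \subset T) && (#|B| == i))); last first.
  by move=> B; rewrite inE.
apply: eq_big => [B|B /andP[sBT /eqP <-]].
  by case sBT: (B \subset T) => //=; rewrite -val_eqE /= inordK // ltnS subset_leq_card.
by rewrite inordK // ltnS subset_leq_card.
Qed.

Definition cube_of_set (n : nat) (A : {set 'I_n}) : cube n := [ffun i => i \in A].

Lemma hweight_cube_of_set (n : nat) (A : {set 'I_n}) : hweight (cube_of_set A) = #|A|.
Proof.
rewrite /hweight -sum1_card [RHS]big_mkcond; apply: eq_bigr => i _.
by rewrite ffunE; case: (i \in A).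
Qed.

Definition initial_set (n w : nat) : {set 'I_n} := [set i : 'I_n | (i < w)%N].

Lemma card_initial_set (n w : nat) : (w <= n)%N -> #|initial_set n w| = w.
Proof.
move=> lewn; rewrite -sum1_card.
rewrite (eq_bigl (fun i : 'I_n => (i < w)%N)) => [|i]; last by rewrite inE.
by rewrite -(big_ord_widen _ (fun=> 1%N) lewn) sum1_card card_ord.
Qed.

(** Total in [w]: past [n] the initial set is everything, so the value stays that at [n]. *)
Definition weight_profile (n : nat) (p : cube n -> bool) (w : nat) : bool :=
  p (cube_of_set (initial_set n w)).

Lemma weight_profileE (n : nat) (p : cube n -> bool) (A : {set 'I_n}) :
  symmetric_fun p -> p (cube_of_set A) = weight_profile p #|A|.
Proof.
move=> psym; apply: psym.
rewrite !hweight_cube_of_set card_initial_set //.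
by rewrite -[leqRHS]card_ord max_card.
Qed.

(** Adding to the first [w] coordinates all subsets of the next [m = 2 ^ t] gives an m-th
    derivative, which vanishes as [d < m]. Grouped by size, its terms carry the weights ['C(m, i)],
    even except for [i = 0] and [i = m], so the two end values agree. *)
Lemma weight_profile_periodic (n d t : nat) (p : cube n -> bool) (w : nat) :
  F2_polynomial_of_degree d p -> symmetric_fun p -> (d < 2 ^ t)%N ->
  (w + 2 ^ t <= n)%N -> weight_profile p (w + 2 ^ t) = weight_profile p w.
Proof.
set m := (2 ^ t)%N => -[P [_ szP evP]] psym ltdm lewn.
set Y := initial_set n w; set T := initial_set n (w + m) :\: Y.
have sub : Y \subset initial_set n (w + m).
  by apply/subsetP => i; rewrite !inE => /leq_trans; apply; rewrite leq_addr.
have cardT : #|T| = m.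
  by rewrite cardsDS // !card_initial_set //; lia.
have /sum_subsets_meval_eq0 -/(_ Y) : (msize P <= #|T|)%N by rewrite cardT szP.
pose v i : 'F_2 := (weight_profile p (w + i))%:R.
have -> : \sum_(B : {set 'I_n} | B \subset T) P.@[fun i => (i \in Y :|: B)%:R]
        = \sum_(B : {set 'I_n} | B \subset T) v #|B|.
  apply: eq_bigr => B sBT.
  rewrite /v -[w in (w + _)%N](card_initial_set (leq_trans (leq_addr m w) lewn)).
  rewrite -cardsUI (_ : _ :&: B = set0) ?cards0 ?addn0; last first.
    apply/setP => i; rewrite !inE; apply/negP => /andP[iw iB].
    by move/subsetP: sBT => /(_ _ iB); rewrite !inE iw.
  rewrite -weight_profileE // -evP; apply: meval_eq => i.
  by rewrite ffunE.
have m_gt0 : (0 < m)%N by rewrite expn_gt0.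
rewrite sum_subsets_card cardT big_ord_recr /= (bigD1 (Ordinal m_gt0)) //=.
rewrite big1 => [|i i_neq0]; last first.
  rewrite -mulr_natr natF2_odd odd_bin_pow2 ?mulr0 //.
  by rewrite ltn_ord lt0n i_neq0.
rewrite bin0 binn !mulr1n addr0 /v addn0.
by do 2![case: weight_profile].
Qed.

(** * Krawtchouk polynomials *)

(** The polynomial acts on [g] as a difference operator with ['X] the forward shift, so products of
    polynomials become compositions of operators. *)
Definition shift_sum (R : comNzRingType) (g : nat -> R) (A : {poly R}) (y : nat) : R :=
  \sum_(a < size A) A`_a * g (y + a)%N.

Lemma shift_sum_widen (R : comNzRingType) (g : nat -> R) (A : {poly R}) (y L : nat) :
  (size A <= L)%N -> shift_sum g A y = \sum_(a < L) A`_a * g (y + a)%N.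
Proof.
move=> leL; rewrite /shift_sum (big_ord_widen L (fun a => A`_a * g (y + a)%N)) //.
rewrite [RHS](bigID (fun a : 'I_L => (a < size A)%N)) /= [X in _ + X]big1 ?addr0 //.
by move=> a; rewrite -leqNgt => /(nth_default 0) ->; rewrite mul0r.
Qed.

Lemma shift_sumD (R : comNzRingType) (g : nat -> R) (A B : {poly R}) (y : nat) :
  shift_sum g (A + B) y = shift_sum g A y + shift_sum g B y.
Proof.
rewrite !(@shift_sum_widen _ _ _ _ (maxn (size A) (size B))) ?leq_maxl ?leq_maxr ?size_polyD //.
by rewrite -big_split; apply: eq_bigr => a _; rewrite coefD mulrDl.
Qed.

Lemma shift_sumZ (R : comNzRingType) (g : nat -> R) (c : R) (A : {poly R}) (y : nat) :
  shift_sum g (c *: A) y = c * shift_sum g A y.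
Proof.
rewrite (shift_sum_widen _ _ (size_scale_leq c A)) /shift_sum mulr_sumr.
by apply: eq_bigr => a _; rewrite coefZ mulrA.
Qed.

Lemma shift_sum_sum (R : comNzRingType) (g : nat -> R) (I : Type) (s : seq I) (P : pred I)
    (A : I -> {poly R}) (y : nat) :
  shift_sum g (\sum_(i <- s | P i) A i) y = \sum_(i <- s | P i) shift_sum g (A i) y.
Proof.
apply: (big_morph (fun A => shift_sum g A y)) => [A' B|]; first exact: shift_sumD.
by rewrite /shift_sum size_poly0 big_ord0.
Qed.

Lemma shift_sumMXn (R : comNzRingType) (g : nat -> R) (A : {poly R}) (a y : nat) :
  shift_sum g (A * 'X^a) y = shift_sum g A (y + a).
Proof.
have szA : (size (A * 'X^a)%R <= a + size A)%N.
  by rewrite (leq_trans (size_polyMleq _ _)) // size_polyXn; lia.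
rewrite (shift_sum_widen _ _ szA) big_split_ord /= big1 ?add0r; last first.
  by move=> i _; rewrite coefMXn ltn_ord mul0r.
apply: eq_bigr => i _; rewrite coefMXn ltnNge leq_addr /= addKn.
by rewrite addnA.
Qed.

Lemma shift_sumXn (R : comNzRingType) (g : nat -> R) (a y : nat) :
  shift_sum g 'X^a y = g (y + a)%N.
Proof.
by rewrite -['X^a]mul1r shift_sumMXn /shift_sum size_poly1 big_ord1 coef1 mul1r addn0.
Qed.

(** The factor [(1 + 'X) ^+ N] stands for [N] further coordinates outside the character set. *)
Lemma shift_sumM_binomial (R : comNzRingType) (g : nat -> R) (A : {poly R}) (N y : nat) :
  shift_sum g (A * (1 + 'X) ^+ N) y
  = \sum_(a < N.+1) 'C(N, a)%:R * shift_sum g A (y + a).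
Proof.
rewrite exprDn mulr_sumr shift_sum_sum; apply: eq_bigr => a _.
rewrite expr1n mul1r -scaler_nat -scalerAr shift_sumZ.
by rewrite shift_sumMXn.
Qed.

Lemma shift_sum_binomial (R : comNzRingType) (g : nat -> R) (N y : nat) :
  shift_sum g ((1 + 'X) ^+ N) y = \sum_(a < N.+1) 'C(N, a)%:R * g (y + a)%N.
Proof.
rewrite -[_ ^+ N]mul1r shift_sumM_binomial; apply: eq_bigr => a _.
by rewrite -(expr0 'X) shift_sumXn addn0.
Qed.

(** Generating polynomial of the character sums over weight levels of the n-cube: each of the [k]
    coordinates in the character gives [1 - 'X], each other one [1 + 'X]. *)
Definition krawtchouk (R : comNzRingType) (n k : nat) : {poly R} :=
  (1 - 'X) ^+ k * (1 + 'X) ^+ (n - k).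

Lemma krawtchouk_gen (R : comNzRingType) (n : nat) (A : {set 'I_n}) :
  \sum_(B : {set 'I_n}) (-1) ^+ #|A :&: B| *: 'X^#|B| = krawtchouk R n #|A|.
Proof.
have -> : krawtchouk R n #|A| = \prod_(i < n) ((-1) ^+ (i \in A) *: 'X + 1).
  rewrite /krawtchouk (bigID (mem A)) /= -prodr_const.
  have -> : (n - #|A|)%N = #|~: A| by rewrite [RHS]cardsCs setCK card_ord.
  rewrite -prodr_const; congr *%R.
    by apply: eq_bigr => i ->; rewrite expr1 scaleN1r addrC.
  rewrite (eq_bigl (fun i => i \notin A)) => [|i]; last by rewrite inE.
  by apply: eq_bigr => i /negPf ->; rewrite expr0 scale1r addrC.
rewrite bigA_distr; apply: eq_bigr => B _.
rewrite -big_mkcond /= scaler_prod prodr_const -expr_sum; congr (_ ^+ _ *: _).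
rewrite -sum1_card big_mkcond [RHS]big_mkcond; apply: eq_bigr => i _.
by rewrite inE andbC; case: (i \in B); case: (i \in A).
Qed.

Lemma coef_krawtchouk (R : comNzRingType) (n w : nat) (A : {set 'I_n}) :
  (krawtchouk R n #|A|)`_w = \sum_(B : {set 'I_n} | #|B| == w) (-1) ^+ #|A :&: B|.
Proof.
rewrite -krawtchouk_gen coef_sum [RHS]big_mkcond; apply: eq_bigr => B _.
by rewrite coefZ coefXn eq_sym; case: eqP => _; rewrite ?mulr1 ?mulr0.
Qed.

(** Both sides sum the sign of [#|A :&: B|] over all pairs of sets of sizes [k] and [w]. *)
Lemma krawtchouk_sym (R : comNzRingType) (n k w : nat) :
  'C(n, k)%:R * (krawtchouk R n k)`_w = 'C(n, w)%:R * (krawtchouk R n w)`_k.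
Proof.
have aux j i : 'C(n, j)%:R * (krawtchouk R n j)`_i =
    \sum_(A : {set 'I_n} | #|A| == j) \sum_(B : {set 'I_n} | #|B| == i) (-1) ^+ #|A :&: B|.
  rewrite (eq_bigr (fun=> (krawtchouk R n j)`_i)) => [|A /eqP <-]; last first.
    by rewrite coef_krawtchouk.
  rewrite mulr_natl -[n in 'C(n, j)]card_ord -card_draws -sumr_const.
  by apply: eq_bigl => A; rewrite inE.
rewrite !aux exchange_big.
by apply: eq_bigr => A _; apply: eq_bigr => B _; rewrite setIC.
Qed.

Lemma size_krawtchouk (R : comNzRingType) (n k : nat) :
  (k <= n)%N -> (size (krawtchouk R n k) <= n.+1)%N.
Proof.
move=> lekn; have := card_initial_set lekn; move: (initial_set n k) => A cA.
rewrite -cA -krawtchouk_gen; apply: (leq_trans (size_sum _ _ _)).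
apply/bigmax_leqP => B _; apply: leq_trans (size_scale_leq _ _) _.
by rewrite size_polyXn ltnS -[leqRHS]card_ord max_card.
Qed.

(** Duality fixes the coefficient index at [k] and lets the polynomial vary with [w], which makes a
    bound of the form [r ^- k] available for all terms at once. *)
Lemma shift_sum_krawtchouk (R : comNzRingType) (g : nat -> R) (n k y : nat) :
  (k <= n)%N ->
  'C(n, k)%:R * shift_sum g (krawtchouk R n k) y
  = \sum_(w < n.+1) 'C(n, w)%:R * (krawtchouk R n w)`_k * g (y + w)%N.
Proof.
move=> lekn; rewrite (shift_sum_widen _ _ (size_krawtchouk R lekn)) mulr_sumr.
by apply: eq_bigr => w _; rewrite mulrA krawtchouk_sym // -ltnS.
Qed.

(** * Fourier coefficients of symmetric functions *)

Lemma cube_of_set_bij (n : nat) : bijective (@cube_of_set n).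
Proof.
exists (fun x : cube n => [set i | x i]) => [A|x].
  by apply/setP => i; rewrite inE ffunE.
by apply/ffunP => i; rewrite ffunE inE.
Qed.

Lemma card_cube (n : nat) : #|cube n| = (2 ^ n)%N.
Proof. by rewrite card_ffun card_bool card_ord. Qed.

Lemma fourier_coef_symmetric (R : realType) (n : nat) (p : cube n -> bool)
    (g : nat -> R) (S : {set 'I_n}) :
  (forall A : {set 'I_n}, (p (cube_of_set A))%:R = g #|A|) ->
  fourier_coef R p S = shift_sum g (krawtchouk R n #|S|) 0 / (2 ^ n)%:R.
Proof.
move=> pg; rewrite /fourier_coef /expect card_cube; congr (_ / _).
rewrite (reindex _ (onW_bij _ (@cube_of_set_bij n))) /= -krawtchouk_gen shift_sum_sum.
apply: eq_bigr => A _; rewrite shift_sumZ shift_sumXn add0n pg mulrC.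
congr (_ ^+ _ * _); rewrite -sum1_card big_mkcond [RHS]big_mkcond /=.
apply: eq_bigr => i _; rewrite inE ffunE.
by case: (i \in S); case: (i \in A).
Qed.

Lemma prob_symmetric (R : realType) (n : nat) (p : cube n -> bool) (g : nat -> R) :
  (forall A : {set 'I_n}, (p (cube_of_set A))%:R = g #|A|) ->
  prob R (fun x => p x == true) = shift_sum g ((1 + 'X) ^+ n) 0 / (2 ^ n)%:R.
Proof.
move=> pg; rewrite /prob card_cube; congr (_ / _).
(* The probability is the Fourier coefficient at the empty set. *)
have := fourier_coef_symmetric set0 pg.
rewrite /fourier_coef /expect card_cube cards0 /krawtchouk expr0 mul1r subn0.
move/(divIf _) => <-; last by rewrite pnatr_eq0 expn_eq0.
rewrite -sum1_card natr_sum big_mkcond; apply: eq_bigr => x _.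
by rewrite inE big_set0 expr0 mulr1; case: (p x).
Qed.

Lemma L1_level_symmetric (R : realType) (n k : nat) (p : cube n -> bool) (g : nat -> R) :
  (forall A : {set 'I_n}, (p (cube_of_set A))%:R = g #|A|) ->
  L1_level R k p = 'C(n, k)%:R * `|shift_sum g (krawtchouk R n k) 0| / (2 ^ n)%:R.
Proof.
move=> pg; rewrite /L1_level.
rewrite (eq_bigr (fun=> `|shift_sum g (krawtchouk R n k) 0| / (2 ^ n)%:R)); last first.
  move=> S /eqP <-; rewrite (fourier_coef_symmetric _ pg) normrM.
  by rewrite [X in _ * X]ger0_norm // invr_ge0 ler0n.
rewrite -mulrA mulr_natl -[n in 'C(n, k)]card_ord -card_draws -sumr_const.
by apply: eq_bigl => A; rewrite inE.
Qed.

(** * Elementary inequalities and coefficient bounds *)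

Lemma bernoulli (R : realFieldType) (x : R) (n : nat) :
  -1 <= x -> 1 + n%:R * x <= (1 + x) ^+ n.
Proof.
move=> x_ge; elim: n => [|n IHn]; first by rewrite mul0r addr0.
rewrite exprS; apply: le_trans (_ : (1 + x) * (1 + n%:R * x) <= _); last first.
  by apply: ler_wpM2l => //; lra.
have := mulr_ge0 (ler0n R n) (sqr_ge0 x); rewrite -natr1 expr2; lra.
Qed.

Lemma expr_subr_le (R : realFieldType) (x : R) (n : nat) :
  0 <= x <= 1 -> (1 - x) ^+ n * (1 + n%:R * x) <= 1.
Proof.
move=> /andP[x0 x1]; apply: le_trans (_ : (1 - x) ^+ n * (1 + x) ^+ n <= _).
  by apply: ler_wpM2l; [apply: exprn_ge0; lra | apply: bernoulli; lra].
by rewrite -exprMn; apply: exprn_ile1; nra.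
Qed.

(** [(1 + x) ^+ q] times [(1 - x) ^+ q] is at most 1, and the second factor is at least 1/2 by
    Bernoulli. *)
Lemma expr_addr_le2 (R : realFieldType) (x : R) (q : nat) :
  0 <= x -> 2 * q%:R * x <= 1 -> (1 + x) ^+ q <= 2.
Proof.
case: q => [|q] x0 qx; first by rewrite expr0; lra.
have q1 : 1 <= q.+1%:R :> R by rewrite ler1n.
have x1 : x <= 1 by nra.
have h1 : 1 - q.+1%:R * x <= (1 - x) ^+ q.+1.
  by rewrite -mulrN; apply: bernoulli; lra.
have h2 : (1 + x) ^+ q.+1 * (1 - x) ^+ q.+1 <= 1 by rewrite -exprMn; apply: exprn_ile1; nra.
have h3 : 1 <= (1 + x) ^+ q.+1 by apply: exprn_ege1; lra.
nra.
Qed.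

Lemma expr_addr_le_exp2 (R : realFieldType) (x : R) (q b a : nat) :
  0 <= x -> 2 * q%:R * x <= 1 -> (a <= q * b)%N -> (1 + x) ^+ a <= 2 ^+ b.
Proof.
move=> x0 qx leab; apply: le_trans (_ : (1 + x) ^+ (q * b) <= _).
  by apply: ler_weXn2l => //; lra.
rewrite exprM; apply: lerXn2r; rewrite ?nnegrE ?exprn_ge0 //; try lra.
exact: expr_addr_le2.
Qed.

Definition majorized (R : realFieldType) (p q : {poly R}) := forall i, `|p`_i| <= q`_i.

Lemma majorizedM (R : realFieldType) (p q p' q' : {poly R}) :
  majorized p q -> majorized p' q' -> majorized (p * p') (q * q').
Proof.
move=> pq pq' i; rewrite !coefM; apply: le_trans (ler_norm_sum _ _ _) _.
by apply: ler_sum => j _; rewrite normrM ler_pM.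
Qed.

Lemma majorizedX (R : realFieldType) (p q : {poly R}) (n : nat) :
  majorized p q -> majorized (p ^+ n) (q ^+ n).
Proof.
move=> pq; elim: n => [|n IHn]; last by rewrite !exprS; apply: majorizedM.
by move=> i; rewrite !expr0 coef1; case: eqP; rewrite ?normr1 ?normr0.
Qed.

(** A Cauchy estimate: the coefficients of [q] are nonnegative, so one term of [q.[r]] is at most
    the whole value. *)
Lemma majorized_coef (R : realFieldType) (p q : {poly R}) (r : R) (k : nat) :
  0 <= r -> majorized p q -> `|p`_k| * r ^+ k <= q.[r].
Proof.
move=> r0 pq; apply: le_trans (_ : q`_k * r ^+ k <= _).
  by apply: ler_wpM2r; rewrite ?exprn_ge0.
have q_ge0 i : 0 <= q`_i * r ^+ i.
  by rewrite mulr_ge0 ?exprn_ge0 // (le_trans (normr_ge0 _) (pq i)).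
rewrite horner_coef; case: (ltnP k (size q)) => [ltk|lek].
  rewrite (bigD1 (Ordinal ltk)) //= lerDl; exact: sumr_ge0.
by rewrite nth_default // mul0r; apply: sumr_ge0.
Qed.

Lemma majorized_1addX (R : realFieldType) (c : R) (j : nat) :
  (0 < j)%N -> `|c| = 1 -> majorized (1 + c *: 'X^j) (1 + 'X^j).
Proof.
move=> j0 c1 i; rewrite !coefD coefZ coef1 coefXn.
case: (eqVneq i 0%N) => [->|_] /=.
  by rewrite ltn_eqF // mulr0 !addr0 normr1.
by rewrite !add0r normrM c1 mul1r normr_nat.
Qed.

(* (1-X)^w (1+X)^(n-w) is (1-X^2)^min(w,n-w) times a power of 1-X or 1+X;
   splitting off the square factor is what makes the bound O(sqrt n)^k at
   the centre. *)
Lemma krawtchouk_bound_high (R : realFieldType) (r : R) (n w k : nat) :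
  0 <= r -> (w <= n)%N -> (n <= w.*2)%N ->
  `|(krawtchouk R n w)`_k| * r ^+ k <= (1 + r ^+ 2) ^+ (n - w) * (1 + r) ^+ (w.*2 - n).
Proof.
move=> r0 lewn lenw.
have -> : (1 + r ^+ 2) ^+ (n - w) * (1 + r) ^+ (w.*2 - n)
   = ((1 + 'X^2) ^+ (n - w) * (1 + 'X^1) ^+ (w.*2 - n)).[r] by rewrite !hornerE.
apply: majorized_coef => //.
have -> : krawtchouk R n w
    = (1 + (-1) *: 'X^2) ^+ (n - w) * (1 + (-1) *: 'X^1) ^+ (w.*2 - n).
  rewrite /krawtchouk !scaleN1r expr1.
  have {1}-> : w = ((n - w) + (w.*2 - n))%N by lia.
  rewrite exprD mulrAC -exprMn; congr (_ ^+ _ * _); ring.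
by apply: majorizedM; apply: majorizedX; apply: majorized_1addX; rewrite ?normrN1.
Qed.

Lemma krawtchouk_bound_low (R : realFieldType) (r : R) (n w k : nat) :
  0 <= r -> (w.*2 <= n)%N ->
  `|(krawtchouk R n w)`_k| * r ^+ k <= (1 + r ^+ 2) ^+ w * (1 + r) ^+ (n - w.*2).
Proof.
move=> r0 lenw.
have -> : (1 + r ^+ 2) ^+ w * (1 + r) ^+ (n - w.*2)
   = ((1 + 'X^2) ^+ w * (1 + 'X^1) ^+ (n - w.*2)).[r] by rewrite !hornerE.
apply: majorized_coef => //.
have -> : krawtchouk R n w = (1 + (-1) *: 'X^2) ^+ w * (1 + 1 *: 'X^1) ^+ (n - w.*2).
  rewrite /krawtchouk scaleN1r scale1r expr1.
  have -> : (n - w)%N = (w + (n - w.*2))%N by lia.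
  rewrite exprD mulrA -exprMn; congr (_ ^+ _ * _); ring.
by apply: majorizedM; apply: majorizedX; apply: majorized_1addX; rewrite ?normrN1 ?normr1.
Qed.

(** Shifting by [m] bounds the part beyond the first window by [rho] times the whole tail. Only
    indices congruent mod [m] are compared, so [f] may carry an arbitrary factor of period [m]. *)
Lemma geometric_tail (R : realFieldType) (f : nat -> R) (rho : R) (n m w0 : nat) :
  0 <= rho -> (forall w, 0 <= f w) ->
  (forall w, (w0 <= w)%N -> (w + m <= n)%N -> f (w + m)%N <= rho * f w) ->
  (1 - rho) * \sum_(w < n.+1 | (w0 <= w)%N) f w
  <= \sum_(w < n.+1 | (w0 <= w < w0 + m)%N) f w.
Proof.
move=> rho0 f0 fstep; set V := \sum_(w < n.+1 | _) f w.
have VE : V = \sum_(w < n.+1 | (w0 <= w < w0 + m)%N) f w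
            + \sum_(w < n.+1 | (w0 + m <= w)%N) f w.
  rewrite /V (bigID (fun w : 'I_n.+1 => (w < w0 + m)%N)) /=; congr (_ + _).
  by apply: eq_bigl => w; lia.
suff : \sum_(w < n.+1 | (w0 + m <= w)%N) f w <= rho * V by rewrite VE; lra.
rewrite /V -(big_geq_mkord _ _ predT) -(big_geq_mkord _ _ predT).
rewrite big_addn mulr_sumr.
apply: le_trans (_ : \sum_(w0 <= w < n.+1 - m) rho * f w <= _).
  rewrite big_nat [leRHS]big_nat; apply: ler_sum => w /andP[w0w wn].
  by apply: fstep => //; lia.
case: (leqP w0 (n.+1 - m)) => [le0|lt0]; last first.
  rewrite big_geq ?(ltnW lt0) //; apply: sumr_ge0 => w _; exact: mulr_ge0.
rewrite [leRHS](big_cat_nat le0) ?leq_subr //= lerDl.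
by apply: sumr_ge0 => w _; apply: mulr_ge0.
Qed.

(** The consecutive ratio is [(n - w) / (w + 1)], and the hypothesis on [s] says exactly that it is
    at most [1 - s]. *)
Lemma bin_succ_le (R : realFieldType) (s : R) (n w : nat) :
  (w <= n)%N -> s * w.+1%:R <= w.*2.+1%:R - n%:R ->
  'C(n, w.+1)%:R <= (1 - s) * 'C(n, w)%:R.
Proof.
move=> lewn sw; have w_gt0 : 0 < w.+1%:R :> R by rewrite ltr0n.
rewrite -(ler_pM2l w_gt0) -natrM mul_bin_left natrM natrB // mulrA.
apply: ler_wpM2r; first exact: ler0n.
by move: sw; rewrite -addnn -addSn natrD -natr1; lra.
Qed.

(** * Dimension at most k m^2 *)

Section SmallDimension.
Variables (R : realFieldType) (n m k : nat).
Hypotheses (m_gt1 : (1 < m)%N) (k_gt0 : (0 < k)%N) (le_n : (n <= k * m ^ 2)%N).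

(** Of order [1 / m]: then [r ^- k] is [(4 m)^k], while [(1 + r ^+ 2) ^+ n] is only exponential in
    [k] for [n <= k m^2]. *)
Let r : R := (4 * m%:R)^-1.

Let rm : r * m%:R = 4^-1.
Proof.
have m0 : m%:R != 0 :> R by rewrite pnatr_eq0; lia.
by rewrite /r invfM -mulrA mulVf // mulr1.
Qed.

Let r_gt0 : 0 < r.
Proof. by rewrite invr_gt0 mulr_gt0 ?ltr0n //; lia. Qed.

Let r_le : r <= 8^-1.
Proof.
have m2 : 2 <= m%:R :> R by rewrite ler_nat.
have := rm; have := r_gt0; nra.
Qed.

(** The majorant that [krawtchouk_bound_high] supplies for one term of the dual sum, scaled by
    [r ^+ k]. *)
Let F (w : nat) : R := 'C(n, w)%:R * ((1 + r ^+ 2) ^+ (n - w) * (1 + r) ^+ (w.*2 - n)).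

Let F_ge0 (w : nat) : 0 <= F w.
Proof. by rewrite !mulr_ge0 ?exprn_ge0 ?ler0n //; have := r_gt0; nra. Qed.

(** From here on [2 w - n] exceeds [n / m], so consecutive binomials have ratio at most
    [1 - 1 / m = 1 - 4 r]. *)
Let w0 := (n./2 + n %/ m + 2)%N.

Let n_half : (n./2.*2 <= n <= n./2.*2.+1)%N.
Proof. by rewrite -{2 3}(odd_double_half n); case: odd; lia. Qed.

Let n_lt : (n < (n %/ m).+1 * m)%N.
Proof. by rewrite ltn_ceil //; lia. Qed.

Let F_succ (w : nat) : (w0 <= w)%N -> (w < n)%N -> F w.+1 <= (1 - 2 * r) * F w.
Proof.
move=> lew ltw; have {}lew : (n + 3 + (n %/ m).*2 <= w.*2)%N.
  by move: lew n_half; rewrite /w0; move: (n %/ m)%N => ?; lia.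
have lt1 : (n <= w.*2)%N by move: lew; move: (n %/ m)%N => ?; lia.
have cond : 4 * r * w.+1%:R <= w.*2.+1%:R - n%:R.
  rewrite -natrB; last by lia.
  have : (w.+1 <= m * (w.*2.+1 - n))%N.
    apply: leq_trans (_ : m * (n %/ m).+1 <= _)%N; first by rewrite mulnC (leq_trans ltw) // ltnW.
    by rewrite leq_mul2l; apply/orP; right; move: lew; move: (n %/ m)%N => ?; lia.
  rewrite -(ler_nat R) natrM => h.
  apply: le_trans (_ : 4 * r * (m%:R * (w.*2.+1 - n)%:R) <= _).
    by apply: ler_wpM2l => //; have := r_gt0; lra.
  by have := rm; rewrite mulrA -(mulrA 4) => ->; lra.
have Cle := bin_succ_le (ltnW ltw) cond.
rewrite /F (_ : (n - w)%N = (n - w.+1).+1); last by lia.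
rewrite (_ : (w.+1.*2 - n)%N = (w.*2 - n).+2); last by lia.
set a := (1 + r ^+ 2) ^+ (n - w.+1); set b := (1 + r) ^+ (w.*2 - n).
have a0 : 0 <= a by apply: exprn_ge0; nra.
have b0 : 0 <= b by apply: exprn_ge0; have := r_gt0; lra.
have -> : (1 + r) ^+ (w.*2 - n).+2 = (1 + r) ^+ 2 * b by rewrite -add2n exprD.
have -> : (1 + r ^+ 2) ^+ (n - w.+1).+1 = (1 + r ^+ 2) * a by rewrite exprS.
apply: le_trans (_ : (1 - 4 * r) * 'C(n, w)%:R * (a * ((1 + r) ^+ 2 * b)) <= _).
  by apply: ler_wpM2r Cle; apply: mulr_ge0 => //; apply: mulr_ge0 => //; apply: sqr_ge0.
have -> : (1 - 4 * r) * 'C(n, w)%:R * (a * ((1 + r) ^+ 2 * b))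
  = ((1 - 4 * r) * (1 + r) ^+ 2) * ('C(n, w)%:R * (a * b)) by ring.
have -> : (1 - 2 * r) * ('C(n, w)%:R * ((1 + r ^+ 2) * a * b))
  = ((1 - 2 * r) * (1 + r ^+ 2)) * ('C(n, w)%:R * (a * b)) by ring.
apply: ler_wpM2r; first by rewrite !mulr_ge0 ?ler0n.
(* The binomial decay [1 - 4 r] outweighs the growth [(1 + r) ^+ 2] and still leaves [1 - 2 r]. *)
have r3 := exprn_ge0 3 (ltW r_gt0); have r2 := sqr_ge0 r.
have : (1 - 2 * r) * (1 + r ^+ 2) - (1 - 4 * r) * (1 + r) ^+ 2
  = 8 * r ^+ 2 + 2 * r ^+ 3 by ring.
lra.
Qed.

Let F_add (w j : nat) : (w0 <= w)%N -> (w + j <= n)%N -> F (w + j)%N <= (1 - 2 * r) ^+ j * F w.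
Proof.
move=> lew; elim: j => [|j IHj] lej; first by rewrite addn0 mul1r.
rewrite addnS exprS -mulrA; apply: le_trans (F_succ _ _) _; try by lia.
by apply: ler_wpM2l; [have := r_le; lra | apply: IHj; lia].
Qed.

Let F_period (w : nat) : (w0 <= w)%N -> (w + m <= n)%N -> F (w + m)%N <= 2 / 3 * F w.
Proof.
move=> lew lewm; apply: le_trans (F_add lew lewm) _; apply: ler_wpM2r => //.
(* Since [2 r m = 1/2], a full period gains [1 / (1 + 1/2) = 2/3]. *)
have := @expr_subr_le R (2 * r) m; rewrite (_ : m%:R * (2 * r) = 2^-1); last first.
  by have := rm; rewrite mulrC; lra.
have : 0 <= 2 * r <= 1 by have := r_le; have := r_gt0; lra.
by move=> h /(_ h); lra.
Qed.

(** Here [n - w <= k m^2] and [2 w - n <= m (2 k + 3)], while [(1 + r ^+ 2) ^+ (m ^ 2)] and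
    [(1 + r) ^+ m] are at most 2; this gives [k + (2 k + 3)] factors 2. *)
Let F_center (w : nat) : (w <= n <= w.*2)%N -> (w < w0 + m)%N ->
  F w <= 2 ^+ (3 * k + 3) * 'C(n, w)%:R.
Proof.
move=> /andP[lewn lenw] ltw; rewrite /F mulrC; apply: ler_wpM2r; first exact: ler0n.
rewrite (_ : (3 * k + 3 = k + (2 * k + 3))%N); last by lia.
rewrite exprD.
have rr := r_gt0.
have rm2 : r * m%:R = 4^-1 := rm.
apply: ler_pM; [by apply: exprn_ge0; nra | by apply: exprn_ge0; lra | |].
  apply: (@expr_addr_le_exp2 _ _ (m ^ 2)); first exact: sqr_ge0.
    rewrite natrX; have -> : 2 * m%:R ^+ 2 * r ^+ 2 = 2 * (r * m%:R) ^+ 2 by ring.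
    by rewrite rm2; lra.
  by rewrite mulnC; lia.
apply: (@expr_addr_le_exp2 _ _ m); rewrite ?ltW //.
  by rewrite -mulrA [m%:R * r]mulrC rm2; lra.
have : (n %/ m <= k * m)%N.
  by rewrite -(@leq_pmul2r m) //; have := leq_trunc_div n m; lia.
by move: ltw; rewrite /w0; nia.
Qed.

(** Below [w0] the bound is termwise; beyond it the tail costs a factor [1 / (1 - 2/3) = 3] over its
    first window. Periodicity is asked only inside [[0, n]], so that the reflection [w -> n - w] of
    [q] qualifies as well. *)
Lemma half_sum_bound (q : nat -> R) :
  (forall w, 0 <= q w) -> (forall w, (w + m <= n)%N -> q (w + m)%N = q w) ->
  \sum_(w < n.+1 | (n <= w.*2)%N)
    q w * ('C(n, w)%:R * ((1 + r ^+ 2) ^+ (n - w) * (1 + r) ^+ (w.*2 - n)))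
  <= 3 * 2 ^+ (3 * k + 3) * \sum_(w < n.+1) q w * 'C(n, w)%:R.
Proof.
move=> q0 qper; set G : R := 2 ^+ _.
have G0 : 0 <= G by rewrite exprn_ge0 ?ler0n.
have qF0 w : 0 <= q w * F w by rewrite mulr_ge0.
have qC0 w : 0 <= q w * 'C(n, w)%:R by rewrite mulr_ge0 ?ler0n.
have center (w : 'I_n.+1) : (n <= w.*2)%N -> (w < w0 + m)%N ->
    q w * F w <= G * (q w * 'C(n, w)%:R).
  move=> lenw ltw; rewrite [leRHS]mulrCA; apply: ler_wpM2l => //.
  by apply: F_center; rewrite // lenw andbT -ltnS.
have tail := @geometric_tail R (fun w => q w * F w) (2 / 3) n m w0.
have {}tail : \sum_(w < n.+1 | (w0 <= w)%N) q w * F w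
    <= 3 * (G * \sum_(w < n.+1 | (w0 <= w)%N) q w * 'C(n, w)%:R).
  have : \sum_(w < n.+1 | (w0 <= w < w0 + m)%N) q w * F w
      <= G * \sum_(w < n.+1 | (w0 <= w)%N) q w * 'C(n, w)%:R.
    rewrite mulr_sumr big_mkcond [leRHS]big_mkcond; apply: ler_sum => w _.
    case: ifP => [/andP[w1 w2]|_]; last by case: ifP => // _; rewrite mulr_ge0.
    by rewrite w1; apply: center => //; move: w1 n_half; rewrite /w0; move: (n %/ m)%N => ?; lia.
  have := tail _ qF0 _; move=> t1 t2.
  suff : (1 - 2 / 3) * \sum_(w < n.+1 | (w0 <= w)%N) q w * F w
    <= G * \sum_(w < n.+1 | (w0 <= w)%N) q w * 'C(n, w)%:R by lra.
  apply: le_trans t2; apply: t1 => [|w lew lewm]; first by lra.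
  by rewrite qper // [leRHS]mulrCA; apply: ler_wpM2l => //; apply: F_period.
have inner : \sum_(w < n.+1 | (n <= w.*2)%N && ~~ (w0 <= w)%N) q w * F w
    <= 3 * (G * \sum_(w < n.+1 | ~~ (w0 <= w)%N) q w * 'C(n, w)%:R).
  rewrite mulrA mulr_sumr big_mkcond [leRHS]big_mkcond; apply: ler_sum => w _.
  case: ifP => [/andP[w1 w2]|_]; last by case: ifP => // _; rewrite !mulr_ge0.
  rewrite w2; apply: le_trans (center _ w1 _) _; first by lia.
  by rewrite -mulrA ler_peMl ?mulr_ge0 //; lra.
rewrite (bigID (fun w : 'I_n.+1 => (w0 <= w)%N)) /= -/(F _).
rewrite [\sum_(w < n.+1) _](bigID (fun w : 'I_n.+1 => (w0 <= w)%N)) /=.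
rewrite mulrDr -!mulrA; apply: lerD => //.
apply: le_trans tail; rewrite le_eqVlt; apply/orP; left; apply/eqP.
by apply: eq_bigl => w; move: n_half; rewrite /w0; move: (n %/ m)%N => ?; lia.
Qed.

Lemma krawtchouk_sum_bound_small (q : nat -> R) :
  (forall w, 0 <= q w) -> (forall w, (w + m <= n)%N -> q (w + m)%N = q w) ->
  `|\sum_(w < n.+1) 'C(n, w)%:R * (krawtchouk R n w)`_k * q w|
  <= (1536 * m%:R) ^+ k * \sum_(w < n.+1) 'C(n, w)%:R * q w.
Proof.
move=> q0 qper.
have rk0 : 0 < r ^+ k by apply: exprn_gt0.
have hi := half_sum_bound q0 qper.
have lo : \sum_(w < n.+1 | (w.*2 <= n)%N)
    q w * ('C(n, w)%:R * ((1 + r ^+ 2) ^+ w * (1 + r) ^+ (n - w.*2)))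
    <= 3 * 2 ^+ (3 * k + 3) * \sum_(w < n.+1) q w * 'C(n, w)%:R.
  (* The lower half is the upper half of the reflected sequence. *)
  have := @half_sum_bound (fun w => q (n - w)%N) (fun w => q0 _).
  rewrite [in X in _ -> X](reindex_inj rev_ord_inj) /=.
  rewrite [X in _ -> _ <= _ * X](reindex_inj rev_ord_inj) /= => h.
  have {}h := h _; rewrite (eq_big (fun w : 'I_n.+1 => (n <= w.*2)%N)
    (fun w : 'I_n.+1 => q (n - w)%N * F w)).
  - apply: le_trans (h _) _ => [w lew|].
      by rewrite -(qper (n - (w + m))%N); [congr (q _); lia | lia].
    rewrite le_eqVlt; apply/orP; left; apply/eqP; congr (_ * _).
    apply: eq_bigr => w _; rewrite subSS; congr (_ * _%:R).
    by rewrite bin_sub // -ltnS.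
  - by move=> w; have := ltn_ord w; lia.
  - move=> w; have := ltn_ord w; rewrite subSS /F => ltw _.
    rewrite bin_sub //; congr (_ * (_ * (_ * _ ^+ _))); lia.
have -> : \sum_(w < n.+1) 'C(n, w)%:R * q w = \sum_(w < n.+1) q w * 'C(n, w)%:R.
  by apply: eq_bigr => w _; rewrite mulrC.
set S := \sum_(w < n.+1) q w * _ in hi lo *.
rewrite -(ler_pM2r rk0); apply: le_trans (_ : 6 * 2 ^+ (3 * k + 3) * S <= _).
  apply: le_trans (_ : \sum_(w < n.+1) q w * ('C(n, w)%:R * (`|(krawtchouk R n w)`_k| * r ^+ k))
      <= _).
    apply: le_trans (ler_wpM2r (ltW rk0) (ler_norm_sum _ _ _)) _.
    rewrite mulr_suml; apply: ler_sum => w _.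
    rewrite !normrM normr_nat (ger0_norm (q0 w)) le_eqVlt; apply/orP; left; apply/eqP; ring.
  rewrite (bigID (fun w : 'I_n.+1 => (n <= w.*2)%N)) /=.
  have : forall a b : R, a <= 3 * 2 ^+ (3 * k + 3) * S ->
    b <= 3 * 2 ^+ (3 * k + 3) * S -> a + b <= 6 * 2 ^+ (3 * k + 3) * S by move=> *; lra.
  apply.
    apply: le_trans hi; apply: ler_sum => w lew; apply: ler_wpM2l => //.
    apply: ler_wpM2l; first exact: ler0n.
    by apply: krawtchouk_bound_high; rewrite ?ltW // -ltnS.
  apply: le_trans lo; rewrite big_mkcond [leRHS]big_mkcond; apply: ler_sum => w _.
  have pos : 0 <= q w * ('C(n, w)%:R * ((1 + r ^+ 2) ^+ w * (1 + r) ^+ (n - w.*2))).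
    by rewrite !mulr_ge0 ?exprn_ge0 ?ler0n //; have := r_gt0; nra.
  case: ifP => [lew|_]; last by case: ifP.
  have {}lew : (w.*2 <= n)%N by lia.
  rewrite lew; apply: ler_wpM2l => //; apply: ler_wpM2l; first exact: ler0n.
  by apply: krawtchouk_bound_low; rewrite ?ltW.
(* As [r m = 1/4], it remains to see [6 * 2 ^+ (3 k + 3) = 48 * 8 ^+ k <= 384 ^+ k], where [k > 0]
   is used. *)
rewrite [leRHS]mulrAC -exprMn (_ : 1536 * m%:R * r = 384); last by have := rm; lra.
apply: ler_wpM2r; first by apply: sumr_ge0 => w _; rewrite mulr_ge0 ?ler0n.
rewrite exprD exprM (_ : 384 = 48 * 2 ^+ 3); last by lra.
set A := (2 ^+ 3) ^+ k; rewrite exprMn -/A.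
have A0 : 0 <= A by rewrite exprn_ge0 ?exprn_ge0 ?ler0n.
have : 48 ^+ 1 <= 48 ^+ k :> R by apply: ler_weXn2l => //; lra.
by move/(ler_wpM2r A0); lra.
Qed.

End SmallDimension.

(** * Contraction for larger dimensions *)

Lemma sum_window (R : nmodType) (f : nat -> R) (a m L : nat) :
  (a + m <= L)%N -> \sum_(w < L | (a <= w < a + m)%N) f w = \sum_(i < m) f (a + i)%N.
Proof.
move=> leL; transitivity (\sum_(a <= w < a + m) f w).
  rewrite (big_nat_widen _ _ _ _ _ leL) big_geq_mkord.
  by apply: eq_bigl => w; rewrite andTb andbC.
by rewrite -{1}[a]add0n big_addn addKn big_mkord; apply: eq_bigr => i _; rewrite addnC.
Qed.

Lemma sum_period (R : zmodType) (q : nat -> R) (m a : nat) :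
  (forall y, q (y + m)%N = q y) -> \sum_(i < m) q (a + i)%N = \sum_(i < m) q i.
Proof.
case: m => [|m] qper; first by rewrite !big_ord0.
elim: a => [|a <-] //; rewrite big_ord_recr [RHS]big_ord_recl /= addrC.
rewrite addn0 addSnnS qper; congr (_ + _).
by apply: eq_bigr => i _; rewrite /bump add1n addSnnS.
Qed.

Lemma sum_period_rev (R : zmodType) (q : nat -> R) (m a : nat) :
  (m <= a.+1)%N -> (forall y, q (y + m)%N = q y) ->
  \sum_(i < m) q (a - i)%N = \sum_(i < m) q i.
Proof.
move=> lem qper; rewrite -(sum_period (a.+1 - m) qper) (reindex_inj rev_ord_inj) /=.
by apply: eq_bigr => i _; congr (q _); have := ltn_ord i; lia.
Qed.

Section Mixing.
Variables (R : realFieldType) (m : nat).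
Hypothesis m_gt1 : (1 < m)%N.

(** [H] is the centre of the weights ['C(M, .)], whose standard deviation is [2 m]; hence they vary
    little over one period next to [H]. *)
Let H := (8 * m ^ 2)%N.
Let M := (16 * m ^ 2)%N.
Let c0 : R := 'C(M, H)%:R.

Let mR_ge2 : 2 <= m%:R :> R.
Proof. by rewrite ler_nat. Qed.

Let mR_neq0 : m%:R != 0 :> R.
Proof. by rewrite pnatr_eq0; lia. Qed.

Let le_mH : (m.*2 <= H)%N.
Proof. by rewrite /H; nia. Qed.

Let M_eq : M = H.*2.
Proof. by rewrite /M /H; lia. Qed.

Let natH : H%:R = 8 * m%:R ^+ 2 :> R.
Proof. by rewrite /H natrM natrX. Qed.

Let natM : M%:R = 16 * m%:R ^+ 2 :> R.
Proof. by rewrite /M natrM natrX. Qed.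

Let bin_le_center (j : nat) : 'C(M, H + j)%:R <= c0.
Proof.
elim: j => [|j IHj]; first by rewrite addn0.
case: (leqP (H + j) M) => [lej|ltj]; last by rewrite bin_small ?ler0n //; lia.
rewrite addnS; apply: le_trans IHj.
have := @bin_succ_le R 0 M (H + j) lej; rewrite subr0 mul1r; apply.
by rewrite mul0r subr_ge0 ler_nat; lia.
Qed.

(** The ratio at [H + i] falls short of 1 by [(2 i + 1) / (H + i + 1)], at most [2 m / (8 m^2)] for
    [i < m]. *)
Let bin_ge_center (i : nat) : (i <= m)%N ->
  (1 - (4 * m%:R)^-1) ^+ i * c0 <= 'C(M, H + i)%:R.
Proof.
set s : R := (4 * m%:R)^-1.
have mR2 := mR_ge2; have s0 : 0 < s by rewrite invr_gt0; lra.
have sm : s * m%:R = 4^-1 by rewrite /s; field.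
elim: i => [|i IHi] lei; first by rewrite mul1r addn0.
rewrite exprS -mulrA.
apply: le_trans (_ : (1 - s) * 'C(M, H + i)%:R <= _).
  by apply: ler_wpM2l; [nra | apply: IHi; lia].
have w_gt0 : 0 < (H + i).+1%:R :> R by rewrite ltr0n.
rewrite addnS -(ler_pM2l w_gt0) -[leRHS]natrM mul_bin_left natrM natrB; last by lia.
rewrite mulrA; apply: ler_wpM2r; first exact: ler0n.
rewrite -natr1 (natrD _ H i) natH natM.
have i0 : 0 <= i%:R :> R by exact: ler0n.
have im : i%:R + 1 <= m%:R :> R by rewrite natr1 ler_nat.
have : s * m%:R ^+ 2 = m%:R / 4 by rewrite expr2 mulrA sm mulrC.
nra.
Qed.

Let bin_window_ge (i : nat) : (i < m)%N -> 3 / 4 * c0 <= 'C(M, H + i)%:R.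
Proof.
move=> lti; apply: le_trans (bin_ge_center (ltnW lti)); apply: ler_wpM2r; first exact: ler0n.
have mR2 := mR_ge2; have s1 : (4 * m%:R)^-1 <= 1 :> R.
  by rewrite invf_le1; lra.
apply: le_trans (_ : 1 + i%:R * - (4 * m%:R)^-1 <= _); last by apply: bernoulli; lra.
have s0 : 0 < (4 * m%:R)^-1 :> R by rewrite invr_gt0; lra.
have sm : (4 * m%:R)^-1 * m%:R = 4^-1 :> R by field.
have im : i%:R <= m%:R :> R by rewrite ler_nat ltnW.
nra.
Qed.

(** Here [2 w + 1 - M >= 2 m] and [w + 1 <= 16 m^2], which would even allow [2 / (16 m)]; 17 turns
    the gain over a period into [1 / (1 + 2/17) = 17/19]. *)
Let tail_step (w : nat) : (H + m <= w)%N -> (w < M)%N ->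
  'C(M, w.+1)%:R <= (1 - 2 / (17 * m%:R)) * 'C(M, w)%:R :> R.
Proof.
move=> lew ltw; have mR2 := mR_ge2; apply: bin_succ_le; first exact: ltnW.
have h1 : w.+1%:R <= 16 * m%:R ^+ 2 :> R.
  by rewrite -natM ler_nat.
have h2 : 2 * m%:R <= w.*2.+1%:R - M%:R :> R.
  rewrite -natrB; last by lia.
  by rewrite -natrM ler_nat; lia.
apply: le_trans h2; apply: le_trans (_ : 2 / (17 * m%:R) * (16 * m%:R ^+ 2) <= _).
  by apply: ler_wpM2l h1; rewrite divr_ge0 //; lra.
rewrite (_ : 2 / (17 * m%:R) * (16 * m%:R ^+ 2) = 32 / 17 * m%:R); last by field.
lra.
Qed.

Let tail_steps (w j : nat) : (H + m <= w)%N -> (w + j <= M)%N ->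
  'C(M, w + j)%:R <= (1 - 2 / (17 * m%:R)) ^+ j * 'C(M, w)%:R :> R.
Proof.
move=> lew; have mR2 := mR_ge2; elim: j => [|j IHj] lej; first by rewrite addn0 mul1r.
rewrite addnS exprS -mulrA; apply: le_trans (tail_step _ _) _; try by lia.
apply: ler_wpM2l; last by apply: IHj; lia.
by rewrite subr_ge0 ler_pdivrMr; lra.
Qed.

Let tail_period (w : nat) : (H + m <= w)%N -> (w + m <= M)%N ->
  'C(M, w + m)%:R <= 17 / 19 * 'C(M, w)%:R :> R.
Proof.
move=> lew lewm; have mR2 := mR_ge2; apply: le_trans (tail_steps lew lewm) _.
apply: ler_wpM2r; first exact: ler0n.
have h : 0 <= (2 / (17 * m%:R) : R) <= 1.
  by rewrite divr_ge0 ?ler_pdivrMr; lra.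
have := expr_subr_le m h; rewrite (_ : m%:R * (2 / (17 * m%:R)) = 2 / 17); last by field.
lra.
Qed.

Let half_upper (q : nat -> R) : (forall w, 0 <= q w) ->
  (forall w, (w + m <= M)%N -> q (w + m)%N = q w) ->
  \sum_(w < M.+1 | (H <= w)%N) 'C(M, w)%:R * q w
  <= 21 / 2 * c0 * \sum_(i < m) q (H + i)%N.
Proof.
move=> q0 qper; set S := \sum_(i < m) _.
have window a : (H <= a)%N -> (a + m <= M.+1)%N ->
    \sum_(w < M.+1 | (a <= w < a + m)%N) 'C(M, w)%:R * q w <= c0 * \sum_(i < m) q (a + i)%N.
  move=> leHa leaM; rewrite (sum_window (fun w => 'C(M, w)%:R * q w) leaM) mulr_sumr; apply: ler_sum => i _.
  apply: ler_wpM2r => //; have := bin_le_center (a + i - H)%N.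
  by rewrite subnKC //; lia.
have win1 := window H (leqnn _) ltac:(lia).
have win2 : \sum_(w < M.+1 | (H + m <= w < H + m + m)%N) 'C(M, w)%:R * q w <= c0 * S.
  apply: le_trans (window _ _ _) _; try by lia.
  rewrite le_eqVlt; apply/orP; left; apply/eqP; congr (_ * _).
  apply: eq_bigr => i _; rewrite addnAC qper //; have := ltn_ord i; lia.
have := @geometric_tail R (fun w => 'C(M, w)%:R * q w) (17 / 19) M m (H + m).
have h1 : 0 <= 17 / 19 :> R by lra.
have h2 w : 0 <= 'C(M, w)%:R * q w by rewrite mulr_ge0 ?ler0n.
move/(_ h1 h2) => tail.
have {}tail : \sum_(w < M.+1 | (H + m <= w)%N) 'C(M, w)%:R * q w <= 19 / 2 * (c0 * S).
  suff : (1 - 17 / 19) * \sum_(w < M.+1 | (H + m <= w)%N) 'C(M, w)%:R * q w <= c0 * S by lra.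
  apply: le_trans win2; apply: tail => w lew lewm.
  by rewrite qper // mulrA; apply: ler_wpM2r => //; apply: tail_period.
(* The first window costs 1 and the tail [1 / (1 - 17/19) = 19/2], together [21/2]. *)
rewrite (bigID (fun w : 'I_M.+1 => (w < H + m)%N)) /=.
have -> : \sum_(w < M.+1 | (H <= w)%N && ~~ (w < H + m)%N) 'C(M, w)%:R * q w
    = \sum_(w < M.+1 | (H + m <= w)%N) 'C(M, w)%:R * q w.
  by apply: eq_bigl => w; lia.
move: win1 tail; rewrite -/S; lra.
Qed.

Let binomial_sum_le (q : nat -> R) : (forall w, 0 <= q w) ->
  (forall w, q (w + m)%N = q w) ->
  \sum_(w < M.+1) 'C(M, w)%:R * q w <= 21 * c0 * \sum_(i < m) q i.
Proof.
move=> q0 qper.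
have hi := half_upper q0 (fun w _ => qper w).
have lo := @half_upper (fun w => q (M - w)%N) (fun w => q0 _) _.
have {}lo : \sum_(w < M.+1 | (H <= w)%N) 'C(M, w)%:R * q (M - w)%N
    <= 21 / 2 * c0 * \sum_(i < m) q (M - (H + i))%N.
  by apply: lo => w lew; rewrite -(qper (M - (w + m))%N); congr (q _); lia.
rewrite (eq_bigr (fun i : 'I_m => q (H - i)%N)) in lo; last first.
  by move=> i _; congr (q _); rewrite M_eq -addnn subnDA addnK.
rewrite sum_period_rev // in lo; last by lia.
rewrite sum_period // in hi.
rewrite (bigID (fun w : 'I_M.+1 => (H <= w)%N)) /=.
suff : \sum_(w < M.+1 | ~~ (H <= w)%N) 'C(M, w)%:R * q w
    <= \sum_(w < M.+1 | (H <= w)%N) 'C(M, w)%:R * q (M - w)%N by lra.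
rewrite [leRHS](reindex_inj rev_ord_inj) /= big_mkcond [leRHS]big_mkcond.
apply: ler_sum => w _; have := ltn_ord w; rewrite subSS => ltw.
case: ifP => [lew|_]; last by case: ifP => // _; rewrite mulr_ge0 ?ler0n.
by rewrite ifT ?bin_sub ?subKn //; lia.
Qed.

(* Doeblin's argument: the kernel C(M, .) dominates 3/4 C(M, M/2) times the
   indicator of one full period; that part annihilates mean-zero functions
   and carries at least 1/28 of the total mass of pi. *)
Lemma binomial_contraction (phi pi : nat -> R) (B : R) (y : nat) :
  0 <= B -> (forall w, `|phi w| <= B * pi w) -> (forall w, 0 <= pi w) ->
  (forall w, phi (w + m)%N = phi w) -> (forall w, pi (w + m)%N = pi w) ->
  \sum_(i < m) phi i = 0 ->
  `|\sum_(a < M.+1) 'C(M, a)%:R * phi (y + a)%N|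
  <= 27 / 28 * B * \sum_(a < M.+1) 'C(M, a)%:R * pi (y + a)%N.
Proof.
move=> B0 phi_le pi0 phi_per pi_per mean0.
have HM : (H + m <= M.+1)%N by lia.
pose ind (a : nat) : R := (H <= a < H + m)%:R.
have ind_sum (f : nat -> R) : (forall w, f (w + m)%N = f w) ->
    \sum_(a < M.+1) ind a * f (y + a)%N = \sum_(i < m) f i.
  move=> fper; rewrite -(sum_period (y + H) fper).
  rewrite [RHS](eq_bigr (fun i : 'I_m => f (y + (H + i))%N)) => [|i _]; last by rewrite addnA.
  rewrite -(sum_window (fun w => f (y + w)%N) HM) [RHS]big_mkcond; apply: eq_bigr => a _.
  by rewrite /ind; case: ifP; rewrite ?mul1r ?mul0r.
have -> : \sum_(a < M.+1) 'C(M, a)%:R * phi (y + a)%N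
    = \sum_(a < M.+1) ('C(M, a)%:R - 3 / 4 * c0 * ind a) * phi (y + a)%N.
  transitivity (\sum_(a < M.+1) 'C(M, a)%:R * phi (y + a)%N
      - 3 / 4 * c0 * \sum_(a < M.+1) ind a * phi (y + a)%N).
    by rewrite ind_sum // mean0 mulr0 subr0.
  rewrite mulr_sumr -sumrB.
  by apply: eq_bigr => a _; ring.
have coef_ge0 a : 0 <= 'C(M, a)%:R - 3 / 4 * c0 * ind a.
  rewrite /ind; case: (boolP (H <= a < H + m)%N) => [/andP[Ha aH]|_]; last first.
    by rewrite mulr0 subr0 ler0n.
  rewrite mulr1 subr_ge0; have := @bin_window_ge (a - H)%N; rewrite subnKC // => -> //.
  by lia.
apply: le_trans (ler_norm_sum _ _ _) _.
apply: le_trans (_ : \sum_(a < M.+1)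
    ('C(M, a)%:R - 3 / 4 * c0 * ind a) * (B * pi (y + a)%N) <= _).
  by apply: ler_sum => a _; rewrite normrM (ger0_norm (coef_ge0 a)); apply: ler_wpM2l.
have -> : \sum_(a < M.+1) ('C(M, a)%:R - 3 / 4 * c0 * ind a) * (B * pi (y + a)%N)
    = B * (\sum_(a < M.+1) 'C(M, a)%:R * pi (y + a)%N - 3 / 4 * c0 * \sum_(i < m) pi i).
  rewrite -(ind_sum _ pi_per) mulrBr mulrA !mulr_sumr -sumrB.
  by apply: eq_bigr => a _; ring.
(* The removed mass has share at least [(3/4) / 21 = 1/28]. *)
have := @binomial_sum_le (fun w => pi (y + w)%N) (fun w => pi0 _).
have pi_per' w : pi (y + (w + m))%N = pi (y + w)%N by rewrite addnA.
move/(_ pi_per'); rewrite sum_period // => h.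
by rewrite [leRHS]mulrAC [leRHS]mulrC; apply: ler_wpM2l => //; lra.
Qed.

End Mixing.

Lemma shift_sum_period (R : comNzRingType) (g : nat -> R) (A : {poly R}) (m y : nat) :
  (forall w, g (w + m)%N = g w) -> shift_sum g A (y + m) = shift_sum g A y.
Proof. by move=> gper; apply: eq_bigr => a _; rewrite addnAC gper. Qed.

(** The factor [1 - 'X] is a difference operator, so the sum over a period telescopes. *)
Lemma shift_sum_mean0 (R : comNzRingType) (g : nat -> R) (A : {poly R}) (m : nat) :
  (forall w, g (w + m)%N = g w) -> \sum_(i < m) shift_sum g ((1 - 'X) * A) i = 0.
Proof.
move=> gper; transitivity (\sum_(i < m) (shift_sum g A i - shift_sum g A i.+1)).
  apply: eq_bigr => i _; rewrite mulrBl mul1r shift_sumD -scaleN1r shift_sumZ mulN1r.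
  by rewrite mulrC -[X in A * X]expr1 shift_sumMXn addn1.
rewrite sumrB [X in _ - X](eq_bigr (fun i : 'I_m => shift_sum g A (1 + i)%N)) //.
rewrite (@sum_period _ (shift_sum g A)) ?subrr // => y.
exact: shift_sum_period.
Qed.

Lemma shift_sum_bound_binomial (R : realFieldType) (g : nat -> R) (A P : {poly R})
    (B : R) (N : nat) :
  (forall y, `|shift_sum g A y| <= B * shift_sum g P y) ->
  forall y, `|shift_sum g (A * (1 + 'X) ^+ N) y| <= B * shift_sum g (P * (1 + 'X) ^+ N) y.
Proof.
move=> AP y; rewrite !shift_sumM_binomial mulr_sumr.
apply: le_trans (ler_norm_sum _ _ _) _; apply: ler_sum => a _.
by rewrite normrM normr_nat mulrCA; apply: ler_wpM2l; rewrite ?ler0n.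
Qed.

(** One application of [binomial_contraction] per block; the factor [1 - 'X] survives each block and
    keeps the mean zero. *)
Lemma shift_sum_contraction (R : realFieldType) (g : nat -> R) (A : {poly R})
    (B : R) (m N t : nat) :
  (1 < m)%N -> (forall w, 0 <= g w) -> (forall w, g (w + m)%N = g w) -> 0 <= B ->
  (forall y, `|shift_sum g ((1 - 'X) * A) y| <= B * shift_sum g ((1 + 'X) ^+ N) y) ->
  forall y, `|shift_sum g ((1 - 'X) * A * (1 + 'X) ^+ (16 * m ^ 2 * t)) y|
    <= (27 / 28) ^+ t * B * shift_sum g ((1 + 'X) ^+ N * (1 + 'X) ^+ (16 * m ^ 2 * t)) y.
Proof.
move=> m1 g0 gper B0 AP; elim: t => [|t IHt] y.
  by rewrite muln0 !expr0 !mulr1 mul1r.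
rewrite mulnS addnC exprD !mulrA 2!shift_sumM_binomial exprS -[_ * _ * B]mulrA.
apply: binomial_contraction => //.
- by rewrite mulr_ge0 ?exprn_ge0 //; lra.
- move=> w; rewrite -exprD shift_sum_binomial.
  by apply: sumr_ge0 => a _; rewrite mulr_ge0 ?ler0n.
- by move=> w; apply: shift_sum_period.
- by move=> w; apply: shift_sum_period.
- by under eq_bigr => i _ do rewrite -mulrA; apply: shift_sum_mean0.
Qed.

(** * Growth of binomial coefficients in the dimension *)

Lemma ffact_le_exp (n k : nat) : (n ^_ k <= n ^ k)%N.
Proof.
elim: k => [|k IHk] //; rewrite ffactnSr expnSr.
by apply: leq_mul => //; apply: leq_subr.
Qed.

Lemma exp_sub_le_ffact (n k : nat) : ((n - k) ^ k <= n ^_ k)%N.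
Proof.
suff : forall j, (j <= k)%N -> ((n - k) ^ j <= n ^_ j)%N by apply.
elim=> [|j IHj] // lejk; rewrite expnSr ffactnSr.
by apply: leq_mul; [apply: IHj; lia | lia].
Qed.

Lemma bin_ratio_le (n N k : nat) : ('C(n, k) * (N - k) ^ k <= 'C(N, k) * n ^ k)%N.
Proof.
rewrite -(leq_pmul2r (fact_gt0 k)) mulnAC bin_ffact [leqRHS]mulnAC bin_ffact mulnC.
by apply: leq_mul; [apply: exp_sub_le_ffact | apply: ffact_le_exp].
Qed.

(** With [a = s %/ k], [k + s <= k * 2 ^ a.+1]; the k-th power costs [2 ^ (k a + k)], and
    [k a <= s]. *)
Lemma exp_add_le (k s : nat) : (0 < k)%N -> ((k + s) ^ k <= k ^ k * 2 ^ (k + s))%N.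
Proof.
move=> k_gt0; have les : (k + s <= k * 2 ^ (s %/ k).+1)%N.
  have := ltn_ceil s k_gt0; have := ltn_expl (s %/ k).+1 (ltnSn 1).
  move: (s %/ k)%N (2 ^ _)%N => a b; nia.
have := leq_exp2r (k + s) (k * 2 ^ (s %/ k).+1) k_gt0; rewrite les expnMn => h.
apply: leq_trans h _; rewrite leq_mul2l -expnM leq_exp2l //; apply/orP; right.
rewrite mulSn leq_add2l; exact: leq_trunc_div.
Qed.

(** With [N = k m^2], the ratio of binomials is at most [(n / (N - k))^k]. As [n <= 449 (k + s) m^2]
    and [N - k >= 3/4 N], the base is at most [599 (k + s) / k]; [exp_add_le] then yields
    [599 ^ k * 2 ^ (k + s)]. *)
Lemma bin_growth_le (n m k s : nat) :
  (1 < m)%N -> (0 < k)%N -> (n <= k * m ^ 2 + 448 * m ^ 2 * s.+1)%N ->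
  ('C(n, k) <= 'C(k * m ^ 2, k) * 1198 ^ k * 2 ^ s)%N.
Proof.
move=> m1 k0 len; set N := (k * m ^ 2)%N.
have m4 : (4 <= m ^ 2)%N by nia.
have Nk : (3 * (k * m ^ 2) <= 4 * (N - k))%N by rewrite /N; nia.
have kn : (k * n <= 599 * (k + s) * (N - k))%N.
  have h1 : (n <= 449 * ((k + s) * m ^ 2))%N.
    apply: leq_trans len _; move: (m ^ 2)%N => X; nia.
  have h2 : (3 * (k * n) <= 449 * (k + s) * (4 * (N - k)))%N.
    apply: leq_trans (leq_mul (leqnn (449 * (k + s))) Nk).
    apply: leq_trans (leq_mul (leqnn 3) (leq_mul (leqnn k) h1)) _.
    by move: (m ^ 2)%N => X; lia.
  by move: (N - k)%N h2 => Z; nia.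
have kk : (0 < k ^ k * (N - k) ^ k)%N by rewrite muln_gt0 !expn_gt0 k0 /=; apply/orP; left; nia.
rewrite -(leq_pmul2r kk).
have -> : ('C(n, k) * (k ^ k * (N - k) ^ k) = k ^ k * ('C(n, k) * (N - k) ^ k))%N by lia.
apply: leq_trans (leq_mul (leqnn _) (bin_ratio_le n N k)) _.
have -> : (k ^ k * ('C(N, k) * n ^ k) = 'C(N, k) * (k * n) ^ k)%N by rewrite expnMn; lia.
have h := leq_exp2r (k * n) (599 * (k + s) * (N - k)) k0; rewrite kn in h.
apply: leq_trans (leq_mul (leqnn _) h) _.
rewrite !expnMn (_ : 1198 ^ k = 599 ^ k * 2 ^ k)%N; last by rewrite -expnMn.
apply: leq_trans (_ : 'C(N, k) * (599 ^ k * (k ^ k * 2 ^ (k + s)) * (N - k) ^ k) <= _)%N.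
  by rewrite leq_mul2l leq_mul2r leq_mul2l exp_add_le // !orbT.
by rewrite expnD; lia.
Qed.

(** * Assembly of the two regimes *)

Lemma level_bound (R : realFieldType) (g : nat -> R) (m n k : nat) :
  (1 < m)%N -> (0 < k)%N -> (k <= n)%N ->
  (forall w, 0 <= g w) -> (forall w, g (w + m)%N = g w) ->
  'C(n, k)%:R * `|shift_sum g (krawtchouk R n k) 0|
  <= (1536 * 1198 * m%:R) ^+ k * shift_sum g ((1 + 'X) ^+ n) 0.
Proof.
move=> m1 k0 lekn g0 gper.
have small n' y : (k <= n')%N -> (n' <= k * m ^ 2)%N ->
    'C(n', k)%:R * `|shift_sum g (krawtchouk R n' k) y|
    <= (1536 * m%:R) ^+ k * shift_sum g ((1 + 'X) ^+ n') y.
  move=> lekn' len'; rewrite -[X in X * `|_|]normr_nat -normrM.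
  rewrite shift_sum_krawtchouk // shift_sum_binomial.
  apply: (@krawtchouk_sum_bound_small R n' m k m1 k0 len' (fun w => g (y + w)%N)) => // w _.
  by rewrite addnA.
have pi_ge0 n' y : 0 <= shift_sum g ((1 + 'X) ^+ n') y.
  by rewrite shift_sum_binomial; apply: sumr_ge0 => a _; rewrite mulr_ge0 ?ler0n.
have exp1198 : 1 <= 1198 ^+ k :> R by apply: exprn_ege1; rewrite ler1n.
have mk_ge0 : 0 <= (1536 * m%:R) ^+ k :> R by rewrite exprn_ge0 // mulr_ge0 ?ler0n.
rewrite mulrAC exprMn.
case: (leqP n (k * m ^ 2)) => [len|ltn].
  apply: le_trans (small n 0%N lekn len) _; apply: ler_wpM2r => //.
  by rewrite ler_peMr.
set N := (k * m ^ 2)%N in ltn; set C : R := 'C(N, k)%:R.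
have lekN : (k <= N)%N by rewrite /N; nia.
have C_gt0 : 0 < C by rewrite ltr0n bin_gt0.
pose B : R := (1536 * m%:R) ^+ k / C.
have B_ge0 : 0 <= B by rewrite divr_ge0 // ltW.
(* Blocks are grouped by 28 because [(27/28)^28 <= 1/2]: each group halves the ratio, which cancels
   the factor [2 ^ s] of [bin_growth_le]. The [c] leftover coordinates only preserve the bound. *)
pose L := (16 * m ^ 2 * 28)%N.
pose s := ((n - N) %/ L)%N; pose c := ((n - N) %% L)%N.
have nE : (n - N = 16 * m ^ 2 * (28 * s) + c)%N.
  by rewrite mulnA -/L mulnC; apply: divn_eq.
have ltc : (c < L)%N by rewrite ltn_mod /L; nia.
have split : krawtchouk R n k = krawtchouk R N k * (1 + 'X) ^+ (16 * m ^ 2 * (28 * s)) * (1 + 'X) ^+ c.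
  rewrite /krawtchouk -!mulrA -!exprD; congr (_ * _ ^+ _); lia.
(* As [k > 0], one factor [1 - 'X] can be split off to provide mean zero. *)
have krawt1 : krawtchouk R N k = (1 - 'X) * ((1 - 'X) ^+ k.-1 * (1 + 'X) ^+ (N - k)).
  by rewrite mulrA -exprS prednK.
have base y : `|shift_sum g ((1 - 'X) * ((1 - 'X) ^+ k.-1 * (1 + 'X) ^+ (N - k))) y|
    <= B * shift_sum g ((1 + 'X) ^+ N) y.
  rewrite -krawt1 /B mulrAC ler_pdivlMr // mulrC; exact: small.
have := shift_sum_bound_binomial c
  (shift_sum_contraction (28 * s) m1 g0 gper B_ge0 base) 0.
rewrite -krawt1 -split -!exprD -addnA -nE subnKC ?(ltnW ltn) // => main.
have decay : (27 / 28) ^+ (28 * s) <= (2 ^+ s)^-1 :> R.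
  by rewrite exprM -exprVn; apply: lerXn2r; rewrite ?nnegrE ?exprn_ge0 ?invr_ge0 //; lra.
have growth : 'C(n, k)%:R <= C * 1198 ^+ k * 2 ^+ s.
  rewrite /C -!natrX -!natrM ler_nat; apply: bin_growth_le => //.
  have : (n = N + L * s + c)%N by move: nE ltn; rewrite /L; lia.
  by move: ltc; rewrite /L => + ->; rewrite -/N; lia.
have s_gt0 : 0 < 2 ^+ s :> R by apply: exprn_gt0; lra.
set pin := shift_sum g ((1 + 'X) ^+ n) 0 in main *.
apply: le_trans (_ : C * 1198 ^+ k * 2 ^+ s * ((2 ^+ s)^-1 * B * pin) <= _).
  apply: ler_pM; rewrite ?ler0n ?normr_ge0 //.
  apply: le_trans main _; apply: ler_wpM2r; first exact: pi_ge0.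
  exact: ler_wpM2r.
rewrite le_eqVlt; apply/orP; left; apply/eqP; rewrite /B.
have -> : C * 1198 ^+ k * 2 ^+ s * ((2 ^+ s)^-1 * ((1536 * m%:R) ^+ k / C) * pin)
  = (C / C) * (2 ^+ s / 2 ^+ s) * ((1536 * m%:R) ^+ k * 1198 ^+ k * pin) by ring.
by rewrite !divff ?gt_eqF // !mul1r.
Qed.

Theorem theorem1p8 (R : realType) :
  exists C : R, 0 < C /\
    forall (n d : nat) (p : cube n -> bool),
      (1 <= d <= n)%N ->
      F2_polynomial_of_degree d p ->
      symmetric_fun p ->
      forall k : nat, (1 <= k <= n)%N ->
        L1_level R k p <= prob R (fun x => p x == true) * (C * d%:R) ^+ k.
Proof.
(* The first two factors come from [level_bound], the last from [m <= 2 d]. *)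
exists (1536 * 1198 * 2); split; first by rewrite !mulr_gt0 ?ltr0n.
move=> n d p /andP[d1 dn] pdeg psym k /andP[k1 kn].
have [] := trunc_log_bounds (ltnSn 1) d1; set t := trunc_log 2 d => /andP[le_t lt_t].
set m := (2 ^ t.+1)%N in lt_t.
have m1 : (1 < m)%N by lia.
have m2d : (m <= 2 * d)%N by rewrite /m expnS; lia.
(* The profile is extended with period [m] to all naturals; it has to agree with [p] only at weights
   up to [n]. *)
pose g w : R := (weight_profile p (w %% m))%:R.
have g0 w : 0 <= g w by rewrite ler0n.
have gper w : g (w + m)%N = g w by rewrite /g modnDr.
have vper q w : (q * m + w <= n)%N -> weight_profile p (q * m + w) = weight_profile p w.
  elim: q => [|q IHq] // leq; rewrite mulSn -addnA addnC.
  rewrite (weight_profile_periodic pdeg psym lt_t) ?IHq //; move: leq; rewrite mulSn -/m; lia.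
have pg (A : {set 'I_n}) : (p (cube_of_set A))%:R = g #|A|.
  rewrite weight_profileE // /g {1}(divn_eq #|A| m) vper // -divn_eq.
  by rewrite -[leqRHS]card_ord max_card.
rewrite (L1_level_symmetric k pg) (prob_symmetric pg) [leRHS]mulrAC.
apply: ler_wpM2r; first by rewrite invr_ge0 ler0n.
apply: le_trans (level_bound m1 k1 kn g0 gper) _; rewrite mulrC.
apply: ler_wpM2l.
  by rewrite shift_sum_binomial; apply: sumr_ge0 => a _; rewrite mulr_ge0 ?ler0n.
apply: lerXn2r; rewrite ?nnegrE ?mulr_ge0 ?ler0n // -[leRHS]mulrA.
by apply: ler_wpM2l; rewrite ?mulr_ge0 ?ler0n // -natrM ler_nat.
Qed.
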